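(* Let $X = x_1,\ldots,x_n$ be a time series and $\epsilon \ge 0$. The set $\tilde{X}$ of line segments output by Algorithm PointBound on $X$ with error bound $\epsilon$ is an $\epsilon$-PLA of $X$ with respect to $maxerr$ (i.e. $maxerr(X,\tilde{X}) \le \epsilon$), and $|\tilde{X}|$ equals the minimum number of segments of any piecewise linear approximation $\tilde{Y}$ of $X$ with $maxerr(X,\tilde{Y}) \le \epsilon$.
   Context: A line segment is $s=((i,y_i),(j,y_j))$ with integers $i<j$ and reals $y_i,y_j$; $[i,j]$ is its range, and it approximates index $k\in[i,j]$ by $\tilde{x}_k = y_i + \frac{k-i}{j-i}(y_j-y_i)$. A set of segments $\tilde{X}$ is a piecewise linear approximation (PLA) of $X = x_1,\ldots,x_n$ if for every index $1\le k\le n$, either $k$ lies in the range of exactly one segment of $\tilde{X}$, or there are two segments of $\tilde{X}$ sharing the same endpoint at index $k$; this gives an approximating value $\tilde{x}_k$ for each $k$. Define $maxerr(X,\tilde{X}) = \max_{1\le k\le n}|x_k - \tilde{x}_k|$. For indices $i<k$, let $poly(i,k)$ be the set of $(y,m)\in\mathbb{R}^2$ with $x_i-\epsilon\le y\le x_i+\epsilon$ and $\frac{(x_k-\epsilon)-y}{k-i}\le m\le\frac{(x_k+\epsilon)-y}{k-i}$. Algorithm PointBound: set $P = poly(1,2)$, $i=1$, $j=3$. Repeat: let $P' = P\cap poly(i,j)$; if $P'\ne\emptyset$, set $P=P'$, $j=j+1$; otherwise choose any $(y,m)\in P$, output segment $((i,y),(j-1,y+(j-1-i)m))$, and set $P=poly(j,j+1)$,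 $i=j$, $j=j+2$. When the input ends, a final segment is output from the current $P$ in the same way. *)

(* Defs.v *)
From HB Require Import structures.
From mathcomp Require Import all_boot all_order all_algebra.
From mathcomp Require Import finmap.
From mathcomp Require Import boolp classical_sets reals.

Set Implicit Arguments.
Unset Strict Implicit.
Unset Printing Implicit Defensive.

Import Order.TTheory GRing.Theory Num.Theory.

Local Open Scope classical_set_scope.
Local Open Scope ring_scope.

(* A time series x_1, ..., x_n is a sequence X : seq R with n = size X, indexed
   from 1; [ts X k] is x_k and is meaningful only for 1 <= k <= size X. *)
Definition ts (R : realType) (X : seq R) (k : nat) : R := X`_k.-1.

(* ((i, y_i), (j, y_j)); the requirement i < j is [wf_segment]. *)
Definition segment (R : realType) : Type := ((int * R) * (int * R))%type.

Definition wf_segment (R : realType) (s : segment R) : bool := s.1.1 < s.2.1.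

Definition in_range (R : realType) (s : segment R) (k : int) : bool :=
  s.1.1 <= k <= s.2.1.

Definition seg_val (R : realType) (s : segment R) (k : int) : R :=
  s.1.2 + (k - s.1.1)%:~R / (s.2.1 - s.1.1)%:~R * (s.2.2 - s.1.2).

Definition has_endpoint (R : realType) (s : segment R) (p : int * R) : bool :=
  (s.1 == p) || (s.2 == p).

(* In the second case nothing is required of further segments whose range
   contains k, so v need not be unique; [approx_val] then selects one. *)
Definition approximates (R : realType) (S : {fset segment R}) (k : int) (v : R)
  : Prop :=
  (exists s : segment R,
     [/\ s \in S, in_range s k,
         forall t : segment R, t \in S -> in_range t k -> t = s
       & v = seg_val s k])
  \/
  (exists s t : segment R,
     [/\ s \in S, t \in S, s != t, has_endpoint s (k, v)
       & has_endpoint t (k, v)]).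

Definition is_PLA (R : realType) (X : seq R) (S : {fset segment R}) : Prop :=
  (forall s : segment R, s \in S -> wf_segment s) /\
  (forall k : nat, (1 <= k <= size X)%N ->
     exists v : R, approximates S k%:Z v).

Definition approx_val (R : realType) (S : {fset segment R}) (k : int) : R :=
  xget 0 [set v : R | approximates S k v].

Definition maxerr (R : realType) (X : seq R) (S : {fset segment R}) : R :=
  \big[Num.max/0]_(1 <= k < (size X).+1) `|ts X k - approx_val S k%:Z|.

Definition eps_PLA (R : realType) (X : seq R) (eps : R) (S : {fset segment R})
  : Prop :=
  is_PLA X S /\ maxerr X S <= eps.

Definition min_eps_PLA_card (R : realType) (X : seq R) (eps : R) (m : nat)
  : Prop :=
  (exists Y : {fset segment R}, eps_PLA X eps Y /\ #|` Y| = m) /\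
  (forall Y : {fset segment R}, eps_PLA X eps Y -> (m <= #|` Y|)%N).

(* Only data points present in the input constrain: the sole occurrence of
   pb_poly i k with k > size X is pb_poly n n.+1, when x_n is alone in its segment,
   and then the slope is unconstrained. *)
Definition pb_poly (R : realType) (X : seq R) (eps : R) (i k : nat)
  : set (R * R) :=
  [set p : R * R |
     ts X i - eps <= p.1 <= ts X i + eps /\
     ((k <= size X)%N ->
        ((ts X k - eps) - p.1) / (k%:R - i%:R) <= p.2
          <= ((ts X k + eps) - p.1) / (k%:R - i%:R))].

Definition out_segment (R : realType) (i j : nat) (p : R * R) : segment R :=
  ((i%:Z, p.1), ((j.-1)%:Z, p.1 + ((j.-1)%:R - i%:R) * p.2)).

(* [pb_run X eps P i j S]: from loop state (P, i, j), the algorithm can output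
   the set S; the choice of a point of P is nondeterministic. *)
Inductive pb_run (R : realType) (X : seq R) (eps : R) :
    set (R * R) -> nat -> nat -> {fset segment R} -> Prop :=
| pb_extend (P : set (R * R)) (i j : nat) (S : {fset segment R}) :
    (j <= size X)%N ->
    P `&` pb_poly X eps i j <> set0 ->
    pb_run X eps (P `&` pb_poly X eps i j) i j.+1 S ->
    pb_run X eps P i j S
| pb_cut (P : set (R * R)) (i j : nat) (p : R * R) (S : {fset segment R}) :
    (j <= size X)%N ->
    P `&` pb_poly X eps i j = set0 ->
    P p ->
    pb_run X eps (pb_poly X eps j j.+1) j j.+2 S ->
    pb_run X eps P i j (out_segment i j p |` S)%fset
| pb_end (P : set (R * R)) (i j : nat) (p : R * R) :
    (size X < j)%N ->
    P p ->
    pb_run X eps P i j [fset out_segment i j p]%fset.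

Definition PointBound (R : realType) (X : seq R) (eps : R)
    (S : {fset segment R}) : Prop :=
  pb_run X eps (pb_poly X eps 1 2) 1 3 S.

(* Main.v *)
(** Whenever PointBound closes a segment that started at [i] because of index
    [j], no single line is within [eps] of the data on all of [i..j]. For any
    [eps]-PLA [Y], this forces at least two segment ends in that window: left
    ends in [(i, j]] and right ends in [[i, j)], counted together. Indeed, if the
    window has no right end, a segment alone at [i] reaches [j], and only two
    segments starting inside the window can keep it from fitting everything; the
    case without left ends is the mirror image, and otherwise there is one of
    each. The windows of successive cuts are disjoint for both kinds of ends;
    together with a left end at or before index 1 and a right end at or after
    the start of the last output segment, [Y] has at least twice as many ends as
    the algorithm outputs segments. Counting ends, rather than comparing
    breakpoints, also covers those [Y] in which further segments run over a
    shared endpoint. *)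

Require Import Defs.
From mathcomp Require Import all_boot all_order all_algebra.
From mathcomp Require Import finmap.
From mathcomp Require Import boolp classical_sets reals.
From mathcomp Require Import zify ring lra.

Set Implicit Arguments.
Unset Strict Implicit.
Unset Printing Implicit Defensive.

Import Order.TTheory GRing.Theory Num.Theory.

Local Open Scope classical_set_scope.
Local Open Scope ring_scope.

(** * Windows without right ends *)

(* [lo], [hi] and [val] are abstract so that the lemma can also be applied to the
   reflected segments. *)
Lemma two_left_ends (T : eqType) (V : Type) (Y : pred T) (lo hi : T -> int)
    (val : T -> int -> V) (ok : int -> V -> Prop) (i j : int) :
  (forall s, Y s -> lo s < hi s) ->
  i + 1 < j ->
  (forall k, i <= k <= j ->
     (exists s, [/\ Y s, lo s <= k <= hi s,
        forall t, Y t -> lo t <= k <= hi t -> t = s & ok k (val s k)]) \/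
     (exists s t, [/\ Y s, Y t & s != t] /\
        [/\ lo s = k \/ hi s = k, lo t = k \/ hi t = k,
            ok k (val s k) & ok k (val t k)])) ->
  (forall s, Y s -> ~ (forall k, i <= k <= j -> ok k (val s k))) ->
  (forall s, Y s -> ~~ (i <= hi s < j)) ->
  exists s t, [/\ Y s, Y t, s != t, i < lo s <= j & i < lo t <= j].
Proof.
move=> wf ij appr unfit noright.
have [//|none] := pselect (exists s t, [/\ Y s, Y t, s != t, i < lo s <= j
  & i < lo t <= j]).
(* Two segments with an end at an interior [k] would both start there, as no right end lies in the
   window; [none] forbids this. *)
have single k : i < k < j -> exists s, [/\ Y s, lo s <= k <= hi s,
        forall t, Y t -> lo t <= k <= hi t -> t = s & ok k (val s k)].
  move=> kij; have [|//|[s [t [[Ys Yt st] [es et _ _]]]]] := appr k.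
    by lia.
  case: none; exists s, t; have := noright _ Ys; have := noright _ Yt.
  by move=> ? ?; split=> //; lia.
have [s1 [Ys1 rs1 us1 _]] := single (i + 1) ltac:(lia).
have [s [Ys rs us oks]] : exists s, [/\ Y s, lo s <= i <= hi s,
        forall t, Y t -> lo t <= i <= hi t -> t = s & ok i (val s i)].
  (* Two segments sharing an end at [i] would both start there and reach [i + 1], which only [s1]
     covers. *)
  have [|//|[s [t [[Ys Yt st] [es et _ _]]]]] := appr i; first by lia.
  have := noright _ Ys; have := noright _ Yt; have := wf _ Ys; have := wf _ Yt.
  move=> ? ? ? ?.
  have es1 : s = s1 by apply: us1 => //; lia.
  have et1 : t = s1 by apply: us1 => //; lia.
  by rewrite es1 et1 eqxx in st.
have hs : j <= hi s by have := noright _ Ys; lia.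
(* Since [s] spans the whole window, it is the unique segment at every index before [j]. *)
have fit k : i <= k < j -> (forall t, Y t -> lo t <= k <= hi t -> t = s) /\
    ok k (val s k).
  move=> kij; have [->//|ki] := eqVneq k i.
  have [s' [_ _ us' oks']] := single k ltac:(lia).
  by have -> : s = s' by apply: us' => //; lia.
exfalso; apply: (unfit s Ys) => k kij.
have [kj|kj] := eqVneq k j; last by apply: (fit k _).2; lia.
subst k.
have [|[s' [_ _ us' oks']]|[a [b [[Ya Yb ab] [ea eb oka okb]]]]] := appr j.
- by lia.
- by have -> : s = s' by apply: us' => //; lia.
(* A segment ending at [j] also covers [j - 1], where [s] is alone. Hence at a shared end either [s]
   takes part or two segments start. *)
have right_s t : Y t -> hi t = j -> t = s.
  move=> Yt ht; have := wf _ Yt => ?.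
  by apply: (fit (j - 1) _).1 => //; lia.
case: ea => ea; last by rewrite -(right_s a).
case: eb => eb; last by rewrite -(right_s b).
by case: none; exists a, b; split=> //; lia.
Qed.

(** * Segments as affine functions *)

Lemma in_range_end (R : realType) (s : segment R) (k : int) (v : R) :
  wf_segment s -> has_endpoint s (k, v) -> in_range s k.
Proof.
rewrite /wf_segment /in_range => wf /orP[] /eqP E; rewrite E /= in wf *; lia.
Qed.

Lemma seg_val_end (R : realType) (s : segment R) (k : int) (v : R) :
  wf_segment s -> has_endpoint s (k, v) ->
  (s.1.1 = k \/ s.2.1 = k) /\ seg_val s k = v.
Proof.
case: s => -[a ya] [b yb]; rewrite /wf_segment /seg_val /= => wf.
case/orP=> /eqP /= [<- <-]; split; rewrite ?subrr ?mul0r ?addr0; auto.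
by rewrite divff ?mul1r 1?addrC ?subrK // intr_eq0; lia.
Qed.

Lemma seg_val_affine (R : realType) (s : segment R) (i k : int) :
  seg_val s k = seg_val s i +
    (k - i)%:~R * ((s.2.2 - s.1.2) / (s.2.1 - s.1.1)%:~R).
Proof. by rewrite /seg_val !rmorphB /=; ring. Qed.

Lemma seg_val_out_segment (R : realType) (i j k : nat) (p : R * R) :
  (i.+1 < j)%N ->
  seg_val (out_segment i j p) k%:Z = p.1 + (k%:R - i%:R) * p.2.
Proof.
move=> ij; rewrite /seg_val /= !rmorphB /= -!pmulrn; field.
by rewrite subr_eq0 eqr_nat; lia.
Qed.

(** * Ends of an [eps]-PLA inside a window *)

Lemma eps_PLA_approximates (R : realType) (X : seq R) (eps : R)
    (Y : {fset segment R}) (k : nat) :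
  eps_PLA X eps Y -> (1 <= k <= size X)%N ->
  exists v, approximates Y k%:Z v /\ `|ts X k - v| <= eps.
Proof.
move=> [[_ ex] err] kX; exists (approx_val Y k%:Z); split.
  exact: (xgetPex 0 (ex k kX)).
apply: le_trans err.
apply: (le_bigmax_seq 0 _ xpredT
  (fun k : nat => `|ts X k - approx_val Y k%:Z|)) => //.
by rewrite mem_index_iota.
Qed.

Lemma count_gt1 (T : eqType) (a : pred T) (r : seq T) (s t : T) :
  s \in r -> t \in r -> s != t -> a s -> a t -> (1 < count a r)%N.
Proof.
move=> sr tr st sa ta; rewrite -size_filter.
apply: (@uniq_leq_size _ [:: s; t]); first by rewrite /= inE st.
by move=> u; rewrite !inE mem_filter => /orP[] /eqP ->; apply/andP.
Qed.

Lemma window_ends (R : realType) (X : seq R) (eps : R) (Y : {fset segment R})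
    (i j : nat) :
  eps_PLA X eps Y -> (0 < i)%N -> (i.+1 < j)%N -> (j <= size X)%N ->
  (forall s : segment R, s \in Y ->
     ~ (forall k, (i <= k <= j)%N -> `|ts X k - seg_val s k%:Z| <= eps)) ->
  (2 <= count (fun s : segment R => (i%:Z < s.1.1 <= j%:Z)%R) Y +
        count (fun s : segment R => (i%:Z <= s.2.1 < j%:Z)%R) Y)%N.
Proof.
move=> YP i0 ij jX unfit.
have wf s : s \in Y -> s.1.1 < s.2.1 by apply: YP.1.1.
pose ok (k : int) (v : R) := `|ts X `|k|%N - v| <= eps.
have appr (k : int) : i%:Z <= k <= j%:Z ->
     (exists s : segment R, [/\ s \in Y, s.1.1 <= k <= s.2.1,
        forall t : segment R, t \in Y -> t.1.1 <= k <= t.2.1 -> t = s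
        & ok k (seg_val s k)]) \/
     (exists s t : segment R, [/\ s \in Y, t \in Y & s != t] /\
        [/\ s.1.1 = k \/ s.2.1 = k, t.1.1 = k \/ t.2.1 = k,
            ok k (seg_val s k) & ok k (seg_val t k)]).
  case: k => [k|k] kij; last by lia.
  have [|v [[[s [sY rs us ->]]|[s [t [sY tY st es et]]]] okv]] :=
    @eps_PLA_approximates _ _ _ _ k YP; first by lia.
    by left; exists s.
  have [ks vs] := seg_val_end (wf _ sY) es.
  have [kt vt] := seg_val_end (wf _ tY) et.
  by right; exists s, t; rewrite vs vt.
have unfit' s : s \in Y ->
    ~ (forall k : int, i%:Z <= k <= j%:Z -> ok k (seg_val s k)).
  by move=> sY fit; apply: (unfit s sY) => k kij; apply: (fit k%:Z); lia.
have [hasr|/hasPn nor] :=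
    boolP (has (fun s : segment R => i%:Z <= s.2.1 < j%:Z) Y).
  have [hasl|/hasPn nol] :=
      boolP (has (fun s : segment R => i%:Z < s.1.1 <= j%:Z) Y).
    by rewrite !has_count in hasl hasr; lia.
  (* The reflection [k -> - k] swaps left and right ends and turns right ends in [[i, j)] into left
     ends in [(- j, - i]]. *)
  have [|||||s [t [sY tY st hs ht]]] := @two_left_ends _ R (mem Y)
    (fun s => - s.2.1) (fun s => - s.1.1) (fun s k => seg_val s (- k))
    (fun k => ok (- k)) (- j%:Z) (- i%:Z).
  - by move=> s /wf; lia.
  - by lia.
  - move=> k kij; have [|[s [sY rs us oks]]|] := appr (- k); first by lia.
      left; exists s; split=> //; first by move=> /=; lia.
      by move=> t tY /= rt; apply: us => //; lia.
    move=> [s [t [Yst [ks kt oks okt]]]].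
    by right; exists s, t; split=> //; split=> //=; lia.
  - move=> s sY fit; apply: (unfit' s sY) => k kij.
    by have := fit (- k); rewrite opprK; apply; lia.
  - by move=> s /nol /=; lia.
  by apply: leq_trans (leq_addl _ _); apply: (count_gt1 sY tY st);
    rewrite /= in hs ht *; lia.
have [||||//|s [t [sY tY st hs ht]]] := @two_left_ends _ R (mem Y)
  (fun s => s.1.1) (fun s => s.2.1) (@seg_val R) ok i%:Z j%:Z.
- exact: wf.
- by lia.
- exact: appr.
- exact: unfit'.
by apply: leq_trans (leq_addr _ _); apply: (count_gt1 sY tY st).
Qed.

(** * Feasible lines and the invariant *)

(** Clearing the positive denominator [k - i] shows [p] as the line with height [p.1] at [i] and
    slope [p.2]. *)
Lemma pb_polyP (R : realType) (X : seq R) (eps : R) (i k : nat) (p : R * R) :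
  (i < k)%N ->
  pb_poly X eps i k p <->
  `|ts X i - p.1| <= eps /\
  ((k <= size X)%N -> `|ts X k - (p.1 + (k%:R - i%:R) * p.2)| <= eps).
Proof.
move=> ik; rewrite /pb_poly /=.
have ki : 0 < k%:R - i%:R :> R by rewrite subr_gt0 ltr_nat.
rewrite !ler_pdivrMr // !ler_pdivlMr // !ler_norml.
by split=> -[h1 h2]; split=> [|kX];
  [lra | have := h2 kX; lra | lra | have := h2 kX; lra].
Qed.

Lemma pb_poly_succ_neq0 (R : realType) (X : seq R) (eps : R) (i : nat) :
  0 <= eps -> pb_poly X eps i i.+1 !=set0.
Proof.
move=> eps0; exists (ts X i, ts X i.+1 - ts X i); apply/pb_polyP => //=.
rewrite subrr normr0; split=> // _.
by rewrite -natr1 addrAC subrr add0r mul1r subrKC subrr normr0.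
Qed.

(* The loop invariant of the algorithm. *)
Definition pb_state (R : realType) (X : seq R) (eps : R) (P : set (R * R))
    (i j : nat) : Prop :=
  [/\ (0 < i <= size X)%N, (i.+1 < j)%N
    & forall p, P p <-> forall k, (i < k < j)%N -> pb_poly X eps i k p].

Lemma pb_state_init (R : realType) (X : seq R) (eps : R) (i : nat) :
  (0 < i <= size X)%N -> pb_state X eps (pb_poly X eps i i.+1) i i.+2.
Proof.
move=> iX; split=> // p; split=> [pP k ik|]; last by apply; lia.
by have -> : k = i.+1 by lia.
Qed.

Lemma pb_state_extend (R : realType) (X : seq R) (eps : R) (P : set (R * R))
    (i j : nat) :
  pb_state X eps P i j -> pb_state X eps (P `&` pb_poly X eps i j) i j.+1.
Proof.
move=> [iX ij PE]; split=> //; first by lia.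
move=> p; split=> [[/PE pP pj] k ik|pP].
  by have [->//|kj] := eqVneq k j; apply: pP; lia.
by split; [apply/PE => k ik|]; apply: pP; lia.
Qed.

Lemma pb_state_fit (R : realType) (X : seq R) (eps : R) (P : set (R * R))
    (i j k : nat) (p : R * R) :
  pb_state X eps P i j -> P p -> (i <= k < j)%N -> (k <= size X)%N ->
  `|ts X k - seg_val (out_segment i j p) k%:Z| <= eps.
Proof.
move=> [iX ij PE] /PE pP kij kX; rewrite seg_val_out_segment //.
have [->|ki] := eqVneq k i.
  have /pb_polyP[//|h _] := pP i.+1 ltac:(lia).
  by rewrite subrr mul0r addr0.
by have /pb_polyP[|_] := pP k ltac:(lia); [lia|apply].
Qed.

(** The value at [i] and the slope of a fitting segment would be a point of the empty intersection.
    The segment may end inside the window, because [seg_val] extends it to a full line. *)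
Lemma pb_cut_unfit (R : realType) (X : seq R) (eps : R) (P : set (R * R))
    (i j : nat) (s : segment R) :
  pb_state X eps P i j -> P `&` pb_poly X eps i j = set0 ->
  ~ (forall k, (i <= k <= j)%N -> `|ts X k - seg_val s k%:Z| <= eps).
Proof.
move=> [iX ij PE] P0 fit.
pose p := (seg_val s i%:Z, (s.2.2 - s.1.2) / (s.2.1 - s.1.1)%:~R).
have pP k : (i < k <= j)%N -> pb_poly X eps i k p.
  move=> ik; apply/pb_polyP; first by lia.
  split=> [|_]; first by apply: fit; lia.
  have := fit k; rewrite (seg_val_affine s i) rmorphB /= -!pmulrn; apply; lia.
have : (P `&` pb_poly X eps i j) p.
  by split; [apply/PE => k ik|]; apply: pP; lia.
by rewrite P0.
Qed.

(** * Termination and correctness of the output *)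

(** Every step increases [j], and the set taken after a cut is nonempty, so a point can always be
    chosen. *)
Lemma pb_run_exists (R : realType) (X : seq R) (eps : R) (P : set (R * R))
    (i j : nat) :
  0 <= eps -> pb_state X eps P i j -> P !=set0 ->
  exists S, pb_run X eps P i j S.
Proof.
move=> eps0; have [m] := ubnP ((size X).+1 - j).
elim: m P i j => // m IH P i j jm st [p Pp].
have [jX|jX] := leqP j (size X); last first.
  by exists [fset out_segment i j p]%fset; apply: pb_end.
have [P0|Pn0] := pselect (P `&` pb_poly X eps i j = set0).
  have [|||S runS] := IH (pb_poly X eps j j.+1) j j.+2; first by lia.
  - by apply: pb_state_init; case: st; lia.
  - exact: pb_poly_succ_neq0.
  by exists (out_segment i j p |` S)%fset; apply: pb_cut.
have [|||S runS] := IH (P `&` pb_poly X eps i j) i j.+1; first by lia.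
- exact: pb_state_extend.
- by apply/set0P/eqP.
by exists S; apply: pb_extend.
Qed.

(** The bound [i <= s.1.1] carries uniqueness through the induction: after a cut, later segments
    start at [j] or beyond, while the closed one ends at [j - 1]. *)
Lemma pb_run_sound (R : realType) (X : seq R) (eps : R) (P : set (R * R))
    (i j : nat) (S : {fset segment R}) :
  pb_run X eps P i j S -> pb_state X eps P i j ->
  (forall s : segment R, s \in S -> wf_segment s /\ i%:Z <= s.1.1) /\
  (forall k, (i <= k <= size X)%N -> exists s : segment R,
     [/\ s \in S, in_range s k%:Z,
         forall t : segment R, t \in S -> in_range t k%:Z -> t = s
       & `|ts X k - seg_val s k%:Z| <= eps]).
Proof.
elim=> {P i j S} [P i j S jX _ _ IH|P i j p S jX P0 Pp _ IH|P i j p jX Pp] st.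
- exact/IH/pb_state_extend.
- have [iX ij _] := st.
  have [|wfS covS] := IH; first by apply: pb_state_init; lia.
  split=> [s|k kX].
    rewrite !inE => /orP[/eqP ->|/wfS[]]; last by split=> //; lia.
    by rewrite /wf_segment /=; split; lia.
  have [kj|kj] := ltnP k j.
    exists (out_segment i j p); split.
    + by rewrite !inE eqxx.
    + by rewrite /in_range /=; lia.
    + move=> t; rewrite !inE => /orP[/eqP //|/wfS[_ jt]].
      by case/andP=> tk _; exfalso; lia.
    + by apply: (pb_state_fit st) => //; lia.
  have [|s [sS rs us oks]] := covS k; first by lia.
  exists s; split=> //; first by rewrite !inE sS orbT.
  move=> t; rewrite !inE => /orP[/eqP ->|]; last exact: us.
  by case/andP=> /= _ jk; exfalso; lia.
- have [iX ij _] := st.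
  split=> [s|k kX].
    by rewrite !inE => /eqP ->; rewrite /wf_segment /=; split; lia.
  exists (out_segment i j p); split.
  + by rewrite inE.
  + by rewrite /in_range /=; lia.
  + by move=> t; rewrite inE => /eqP.
  + by apply: (pb_state_fit st) => //; lia.
Qed.

(** Unique coverage excludes shared ends, so [approx_val] can only select the value of the covering
    segment. *)
Lemma unique_cover_eps_PLA (R : realType) (X : seq R) (eps : R)
    (S : {fset segment R}) :
  0 <= eps ->
  (forall s : segment R, s \in S -> wf_segment s) ->
  (forall k, (1 <= k <= size X)%N -> exists s : segment R,
     [/\ s \in S, in_range s k%:Z,
         forall t : segment R, t \in S -> in_range t k%:Z -> t = s
       & `|ts X k - seg_val s k%:Z| <= eps]) ->
  eps_PLA X eps S.
Proof.
move=> eps0 wf cov; split.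
  split=> // k /cov[s [sS rs us _]].
  by exists (seg_val s k%:Z); left; exists s.
rewrite /maxerr big_nat; apply: bigmax_le => // k kX.
have [|s [sS rs us oks]] := cov k; first by lia.
have : approximates S k%:Z (approx_val S k%:Z).
  by apply: (@xgetI _ 0 _ (seg_val s k%:Z)); left; exists s.
case=> [[t [tS rt _ ->]]|[t [u [tS uS tu et eu]]]]; first by rewrite (us t).
have tE := us _ tS (in_range_end (wf _ tS) et).
have uE := us _ uS (in_range_end (wf _ uS) eu).
by rewrite tE uE eqxx in tu.
Qed.

(** * Optimality by counting ends *)

Lemma eps_PLA_cover (R : realType) (X : seq R) (eps : R) (Y : {fset segment R})
    (k : nat) :
  eps_PLA X eps Y -> (1 <= k <= size X)%N ->
  exists2 s : segment R, s \in Y & in_range s k%:Z.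
Proof.
move=> YP kX; have [v [[[s [sY rs _ _]]|[s [_ [sY _ _ es _]]]] _]] :=
  eps_PLA_approximates YP kX; exists s => //.
exact: in_range_end (YP.1.1 s sY) es.
Qed.

Lemma count_disjoint_le (T : Type) (a b c : pred T) (r : seq T) :
  (forall x, a x -> c x) -> (forall x, b x -> c x && ~~ a x) ->
  (count a r + count b r <= count c r)%N.
Proof.
move=> ac bc; rewrite -count_predUI.
rewrite (@eq_count _ (predI a b) pred0) ?count_pred0 ?addn0.
  by apply: sub_count => x /orP[/ac|/bc/andP[]].
by move=> x /=; apply/negP => /andP[ax /bc]; rewrite ax andbF.
Qed.

(** Each cut pays for its segment with two ends of [Y]. The last segment is sure of one right end
    only, and the successor on the right lends the other. *)
Lemma pb_run_card (R : realType) (X : seq R) (eps : R) (P : set (R * R))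
    (i j : nat) (S Y : {fset segment R}) :
  pb_run X eps P i j S -> pb_state X eps P i j -> eps_PLA X eps Y ->
  (2 * #|` S| <= (count (fun s : segment R => (i%:Z < s.1.1)%R) Y +
                  count (fun s : segment R => (i%:Z <= s.2.1)%R) Y).+1)%N.
Proof.
move=> run st YP.
elim: run st =>
  {P i j S} [P i j S jX _ _ IH|P i j p S jX P0 Pp _ IH|P i j p jX Pp] st.
- exact/IH/pb_state_extend.
- have [iX ij _] := st.
  have IHS := IH (pb_state_init _ _); have {IHS} := IHS ltac:(lia).
  have := window_ends YP _ ij jX (fun s _ => pb_cut_unfit st P0).
  have := @count_disjoint_le _ (fun s : segment R => j%:Z < s.1.1)
    (fun s => i%:Z < s.1.1 <= j%:Z) (fun s => i%:Z < s.1.1) Y.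
  have := @count_disjoint_le _ (fun s : segment R => j%:Z <= s.2.1)
    (fun s => i%:Z <= s.2.1 < j%:Z) (fun s => i%:Z <= s.2.1) Y.
  move=> /(_ ltac:(lia) ltac:(lia)) hr /(_ ltac:(lia) ltac:(lia)) hl hw IHS.
  have {hw} := hw ltac:(lia).
  (* Whether or not the segment is new, the cardinality grows by at most one. *)
  by rewrite cardfsU1; case: (_ \notin _); lia.
- have [iX ij _] := st.
  have [s sY rs] := eps_PLA_cover YP iX.
  have : (0 < count (fun s : segment R => (i%:Z <= s.2.1)%R) Y)%N.
    by rewrite -has_count; apply/hasP; exists s => //; case/andP: rs.
  by rewrite cardfs1; lia.
Qed.

Lemma PointBound_card (R : realType) (X : seq R) (eps : R)
    (S Y : {fset segment R}) :
  (0 < size X)%N -> PointBound X eps S -> eps_PLA X eps Y ->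
  (#|` S| <= #|` Y|)%N.
Proof.
move=> X0 run YP.
have := pb_run_card run (@pb_state_init _ X eps 1 X0) YP.
have [|s sY /andP[ls _]] := @eps_PLA_cover _ _ _ _ 1 YP; first by rewrite X0.
have cr : (count (fun s : segment R => (1%:Z <= s.2.1)%R) Y <= #|` Y|)%N.
  exact: count_size.
have cl : (count (fun s : segment R => (1%:Z < s.1.1)%R) Y < #|` Y|)%N.
  rewrite -(count_predC (fun s : segment R => (1%:Z < s.1.1)%R) Y) -addn1.
  rewrite leq_add2l.
  by rewrite -has_count; apply/hasP; exists s => //=; rewrite -leNgt.
by lia.
Qed.

Theorem theorem3 (R : realType) (X : seq R) (eps : R)
    (X_nonempty : (0 < size X)%N) (eps_ge0 : 0 <= eps) :
  (exists S : {fset segment R}, PointBound X eps S) /\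
  (forall S : {fset segment R}, PointBound X eps S ->
     eps_PLA X eps S /\ min_eps_PLA_card X eps #|` S|).
Proof.
have st := @pb_state_init _ X eps 1 X_nonempty.
split.
  exact: pb_run_exists eps_ge0 st (pb_poly_succ_neq0 X 1 eps_ge0).
move=> S run; have [wfS covS] := pb_run_sound run st.
have SP : eps_PLA X eps S.
  by apply: unique_cover_eps_PLA => // s /wfS[].
split=> //; split; first by exists S.
by move=> Y; apply: PointBound_card.
Qed.
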